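(* Let $G=(V,E,w)$ be a directed graph with $|V|=n$, $|E|=m$ and positive integer vertex weights $w:V\to\mathbb{Z}^+$. Let $G'=(V',E',w')$ be the undirected vertex-weighted graph defined as follows: $V'=V_{\mathrm{out}}\cup V_{\mathrm{in}}$ where $V_{\mathrm{out}}=\{v_{\mathrm{out}}:v\in V\}$ and $V_{\mathrm{in}}=\{v_{\mathrm{in}}:v\in V\}$ are two disjoint copies of $V$; $E'$ consists of all pairs $\{u_{\mathrm{out}},v_{\mathrm{out}}\}$ with $u\neq v$ (a clique on $V_{\mathrm{out}}$), all pairs $\{u_{\mathrm{in}},v_{\mathrm{in}}\}$ with $u\neq v$ (a clique on $V_{\mathrm{in}}$), the matching edges $\{v_{\mathrm{out}},v_{\mathrm{in}}\}$ for all $v\in V$, and the edges $\{u_{\mathrm{out}},v_{\mathrm{in}}\}$ for all $(u,v)\in E$; and $w'(v_{\mathrm{out}})=w'(v_{\mathrm{in}})=w(v)$ for all $v\in V$. Then $G'$ has $2n$ vertices and $O(n^2)$ edges, and each of the following directed vertex cut problems on $G$ can be solved using an algorithm for the corresponding undirected problem on $G'$: global minimum vertex cut, all-pairs minimum vertex cut, single-source minimum vertex cut, single-sink minimum vertex cut, and Steiner minimum vertex cut. For the Steiner variant with terminal set $T\subseteq V$, the terminal set given to the undirected problem is $T'=\{t_{\mathrm{out}}:t\in T\}\cup\{t_{\mathrm{in}}:t\in T\}$, of size $2|T|$.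
   Context: A vertex cut of a (directed or undirected) graph with vertex set $V$ is a tripartition $(L,S,R)$ of $V$ with $L,R$ nonempty such that there is no edge from a vertex of $L$ to a vertex of $R$ (for undirected graphs: no edge between $L$ and $R$); $S$ is the separator, and its weight is $w(S)=\sum_{v\in S}w(v)$. It is an $(s,t)$-vertex cut if $s\in L$, $t\in R$. Global minimum vertex cut: find a vertex cut minimizing $w(S)$. All-pairs: for every pair $(s,t)$ find a minimum-weight $(s,t)$-vertex cut (or report none exists). Single-source (resp. single-sink): given $s$ (resp. $t$), find a minimum-weight vertex cut with $s\in L$ (resp. $t\in R$). Steiner: given a terminal set $T$, find a minimum-weight vertex cut with $L\cap T\neq\emptyset$ and $R\cap T\neq\emptyset$. Input graphs are assumed non-complete so that a vertex cut exists. *)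

(* Defs.v *)
From mathcomp Require Import all_boot.

Set Implicit Arguments.
Unset Strict Implicit.
Unset Printing Implicit Defensive.

(* Arcs are a set of ordered pairs; loops are allowed and play no role below. *)
Record wdigraph := WDigraph {
  dvertex :> finType;
  arcs : {set dvertex * dvertex};
  dweight : dvertex -> nat;
  dweight_gt0 : forall v, 0 < dweight v
}.

Record wgraph := WGraph {
  uvertex :> finType;
  edges : {set {set uvertex}};
  edges_card2 : forall e, e \in edges -> #|e| = 2;
  uweight : uvertex -> nat;
  uweight_gt0 : forall v, 0 < uweight v
}.

(* What vertex cuts see of a graph, directed or not: [link u v] means that
   there is an edge from u to v, and is symmetric for an undirected graph. *)
Record network := Network {
  nvertex :> finType;
  link : rel nvertex;
  nweight : nvertex -> nat
}.

Definition directed (G : wdigraph) : network :=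
  Network (fun u v : G => (u, v) \in arcs G) (@dweight G).

Definition undirected (H : wgraph) : network :=
  Network (fun x y : H => [set x; y] \in edges H) (@uweight H).

Definition noncomplete (N : network) : Prop :=
  exists u v : N, u != v /\ ~~ link u v.

Record triple (V : finType) := Triple {
  left_side : {set V};
  separator : {set V};
  right_side : {set V}
}.

Definition tripartition (V : finType) (c : triple V) : Prop :=
  [/\ left_side c :|: separator c :|: right_side c = [set: V],
      [disjoint left_side c & separator c],
      [disjoint left_side c & right_side c]
    & [disjoint separator c & right_side c]].

Definition vertex_cut (N : network) (c : triple N) : Prop :=
  [/\ tripartition c,
      left_side c != set0,
      right_side c != set0
    & forall u v, u \in left_side c -> v \in right_side c -> ~~ link u v].

Definition cut_weight (N : network) (c : triple N) : nat :=
  \sum_(v in separator c) nweight v.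

Definition min_cut (N : network) (P : triple N -> Prop) (c : triple N) : Prop :=
  [/\ vertex_cut c, P c
    & forall c', vertex_cut c' -> P c' -> cut_weight c <= cut_weight c'].

(* [None] reports that no vertex cut satisfies P. *)
Definition min_cut_or_none (N : network) (P : triple N -> Prop)
    (o : option (triple N)) : Prop :=
  if o is Some c then min_cut P c else forall c, vertex_cut c -> ~ P c.

Definition separates (N : network) (s t : N) (c : triple N) : Prop :=
  s \in left_side c /\ t \in right_side c.

Definition has_source (N : network) (s : N) (c : triple N) : Prop :=
  s \in left_side c.

Definition has_sink (N : network) (t : N) (c : triple N) : Prop :=
  t \in right_side c.

Definition splits_terminals (N : network) (T : {set N}) (c : triple N) : Prop :=
  left_side c :&: T != set0 /\ right_side c :&: T != set0.

Record problem := Problem {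
  input : Type;
  admissible : input -> Prop;
  output : input -> Type;
  answer : forall x, output x -> Prop
}.

Definition algorithm (P : problem) : Type := forall x : input P, output x.

Definition correct_on (P : problem) (A : algorithm P) (x : input P) : Prop :=
  admissible x -> answer (A x).

(* The five problems on a class C of graphs, [net] being [directed] or
   [undirected].  Non-completeness guarantees that a vertex cut exists, but not
   one with a prescribed source, sink or terminal set. *)
Definition global_cut (C : Type) (net : C -> network) : problem :=
  @Problem C
    (fun G => noncomplete (net G))
    (fun G => triple (net G))
    (fun G c => min_cut (fun _ => True) c).

Definition all_pairs_cut (C : Type) (net : C -> network) : problem :=
  @Problem C
    (fun G => noncomplete (net G))
    (fun G => net G -> net G -> option (triple (net G)))
    (fun G f => forall s t, min_cut_or_none (separates s t) (f s t)).

Definition single_source_cut (C : Type) (net : C -> network) : problem :=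
  @Problem {G : C & net G}
    (fun x => noncomplete (net (tag x)))
    (fun x => option (triple (net (tag x))))
    (fun x o => min_cut_or_none (has_source (tagged x)) o).

Definition single_sink_cut (C : Type) (net : C -> network) : problem :=
  @Problem {G : C & net G}
    (fun x => noncomplete (net (tag x)))
    (fun x => option (triple (net (tag x))))
    (fun x o => min_cut_or_none (has_sink (tagged x)) o).

Definition steiner_cut (C : Type) (net : C -> network) : problem :=
  @Problem {G : C & {set net G}}
    (fun x => noncomplete (net (tag x)))
    (fun x => option (triple (net (tag x))))
    (fun x o => min_cut_or_none (splits_terminals (tagged x)) o).

(* The undirected graph G': v_out is [inl v] and v_in is [inr v]. *)
Section SplitGraph.
Variable G : wdigraph.

Definition split_vertex : finType := (G + G)%type.

Definition vout (v : G) : split_vertex := inl v.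
Definition vin (v : G) : split_vertex := inr v.

Definition split_edges : {set {set split_vertex}} :=
  [set [set vout u; vout v] | u in [set: G], v in [set: G] & u != v]
  :|: [set [set vin u; vin v] | u in [set: G], v in [set: G] & u != v]
  :|: [set [set vout v; vin v] | v in [set: G]]
  :|: [set [set vout a.1; vin a.2] | a in arcs G].

Definition split_weight (x : split_vertex) : nat :=
  match x with inl v | inr v => dweight v end.

Lemma split_edges_card2 e : e \in split_edges -> #|e| = 2.
Proof.
rewrite !inE -!orbA => /or4P[/imset2P[u v _]|/imset2P[u v _]|/imsetP[v _]|/imsetP[a _]].
- by rewrite !inE /= => uv ->; rewrite cards2 (inj_eq inl_inj) uv.
- by rewrite !inE /= => uv ->; rewrite cards2 (inj_eq inr_inj) uv.
- by move=> ->; rewrite cards2.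
- by move=> ->; rewrite cards2.
Qed.

Lemma split_weight_gt0 x : 0 < split_weight x.
Proof. by case: x => v; apply: dweight_gt0. Qed.

Definition split_graph : wgraph := WGraph split_edges_card2 split_weight_gt0.

Definition split_terminals (T : {set G}) : {set split_vertex} :=
  (vout @: T) :|: (vin @: T).

(* The cliques force one side of a vertex cut of G' into V_out and the other
   into V_in; the side in V_out becomes the left side, in either orientation. *)
Definition pull_back (c : triple split_vertex) : triple G :=
  let S := [set v | (vout v \in separator c) && (vin v \in separator c)] in
  if [exists v, vout v \in left_side c] then
    Triple [set v | vout v \in left_side c] S [set v | vin v \in right_side c]
  else
    Triple [set v | vout v \in right_side c] S [set v | vin v \in left_side c].

End SplitGraph.

(* One call to the undirected algorithm on G', then [pull_back], which looks
   neither at the arcs nor at the weights of G. *)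
Definition global_via (A : algorithm (global_cut undirected)) :
    algorithm (global_cut directed) :=
  fun G => @pull_back G (A (split_graph G)).

Definition all_pairs_via (A : algorithm (all_pairs_cut undirected)) :
    algorithm (all_pairs_cut directed) :=
  fun G s t => omap (@pull_back G) (A (split_graph G) (vout s) (vin t)).

Definition single_source_via (A : algorithm (single_source_cut undirected)) :
    algorithm (single_source_cut directed) :=
  fun x => let: existT G s := x in
    omap (@pull_back G) (A (existT _ (split_graph G) (vout s))).

Definition single_sink_via (A : algorithm (single_sink_cut undirected)) :
    algorithm (single_sink_cut directed) :=
  fun x => let: existT G t := x in
    omap (@pull_back G) (A (existT _ (split_graph G) (vin t))).

Definition steiner_via (A : algorithm (steiner_cut undirected)) :
    algorithm (steiner_cut directed) :=
  fun x => let: existT G T := x in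
    omap (@pull_back G) (A (existT _ (split_graph G) (split_terminals T))).

(* Main.v *)
(** In a vertex cut of G', a side that meets V_out forces, through the clique
    on V_out, the other side into V_in, and this in turn forces the first side
    into V_out.  Up to exchanging the two sides, the vertex cuts of G' are thus
    the triples (L_out, S', R_in), with L and R disjoint because of the matching
    edges, and they correspond to the vertex cuts (L, S, R) of G.  Each vertex
    of L or R has exactly one copy in S' and each vertex of S has both, so
    w'(S') = w(V) + w(S): minimizers correspond to minimizers. *)
Require Import Defs.
From mathcomp Require Import all_boot.

Set Implicit Arguments.
Unset Strict Implicit.
Unset Printing Implicit Defensive.

(** * Generalities on edge counts, tripartitions and exchanging sides *)

Lemma card_edges (H : wgraph) : #|edges H| <= #|uvertex H| ^ 2.
Proof.
rewrite -mulnn -card_prod.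
apply: leq_trans (leq_imset_card (fun p : H * H => [set p.1; p.2]) predT).
apply/subset_leq_card/subsetP => e /edges_card2/eqP/cards2P[x [y [_ ->]]].
by apply/imsetP; exists (x, y).
Qed.

(** The pointwise form reduces each partition argument to a boolean case analysis on memberships. *)
Lemma tripartitionP (V : finType) (c : triple V) :
  tripartition c <->
  forall v, [|| [&& v \in left_side c, v \notin separator c
                  & v \notin right_side c],
                [&& v \notin left_side c, v \in separator c
                  & v \notin right_side c]
              | [&& v \notin left_side c, v \notin separator c
                  & v \in right_side c]].
Proof.
split=> [[cT /pred0P dLS /pred0P dLR /pred0P dSR] v | cV].
  have := in_setT v; rewrite -cT !inE; move: (dLS v) (dLR v) (dSR v) => /=.
  by do 3!case: (_ \in _).
split.
  by apply/setP => v; have := cV v; rewrite !inE; do 3!case: (_ \in _).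
all: apply/pred0P => v /=; have := cV v; by do 3!case: (_ \in _).
Qed.

Definition flip (V : finType) (c : triple V) : triple V :=
  Triple (right_side c) (separator c) (left_side c).

Lemma vertex_cut_flip (H : wgraph) (c : triple (undirected H)) :
  vertex_cut c -> vertex_cut (flip c).
Proof.
case=> /tripartitionP cV L0 R0 cLR; split=> //=; last first.
  by move=> u v uR vL; rewrite setUC; apply: cLR.
by apply/tripartitionP => v /=; have := cV v; do 3!case: (_ \in _).
Qed.

(** * Edges of G' *)

Section Split.
Variable G : wdigraph.
Implicit Types (u v : G) (c : triple (undirected (split_graph G))).
Implicit Types (d : triple (directed G)).

Lemma split_edge_out u v : u != v -> [set vout u; vout v] \in split_edges G.
Proof.
move=> uv; rewrite !inE -!orbA; apply/or4P/Or41.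
by apply/imset2P; exists u v; rewrite ?inE.
Qed.

Lemma split_edge_in u v : u != v -> [set vin u; vin v] \in split_edges G.
Proof.
move=> uv; rewrite !inE -!orbA; apply/or4P/Or42.
by apply/imset2P; exists u v; rewrite ?inE.
Qed.

(** A mixed pair lies in neither clique and determines both its endpoints, so only a matching edge
    or an arc can produce it. The arcs of G enter cuts of G' through this equation alone. *)
Lemma split_edge_outin u v :
  ([set vout u; vin v] \in split_edges G) = (u == v) || ((u, v) \in arcs G).
Proof.
apply/idP/orP => [|uv]; last first.
  rewrite !inE -!orbA; apply/or4P; case: uv => [/eqP->|uv].
    by apply/Or43/imsetP; exists v; rewrite ?inE.
  by apply/Or44/imsetP; exists (u, v).
have eq_outin x y : [set vout u; vin v] = [set vout x; vin y] -> u = x /\ v = y.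
  move/setP=> e; have := e (vout u); have := e (vin v).
  by rewrite !inE !eqxx /= orbF => /esym/eqP[->] /esym/eqP[->].
rewrite !inE -!orbA => /or4P[/imset2P[x y _ _]|/imset2P[x y _ _]|/imsetP[x _]|].
- by move/setP/(_ (vin v)); rewrite !inE eqxx.
- by move/setP/(_ (vout u)); rewrite !inE eqxx.
- by case/eq_outin=> -> ->; left.
- by case/imsetP=> -[x y] xy /eq_outin[-> ->]; right.
Qed.

Lemma noncomplete_split :
  noncomplete (directed G) -> noncomplete (undirected (split_graph G)).
Proof.
case=> u [v [uv nuv]]; exists (vout u), (vin v); split=> //=.
by rewrite split_edge_outin negb_or uv.
Qed.

(** * Shape of the vertex cuts of G' *)

Lemma cut_out_notin_right c u v :
  vertex_cut c -> vout u \in left_side c -> vout v \notin right_side c.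
Proof.
case=> /tripartitionP cV _ _ cLR uL; apply/negP => vR.
(* The clique has no loops: for equal vertices the contradiction comes from disjointness of the
   sides instead. *)
have [uv|uv] := eqVneq u v.
  by have := cV (vout u); rewrite uL uv vR /= andbF.
by have := cLR _ _ uL vR; rewrite /= split_edge_out.
Qed.

Lemma cut_in_notin_left c u v :
  vertex_cut c -> vin u \in right_side c -> vin v \notin left_side c.
Proof.
case=> /tripartitionP cV _ _ cLR uR; apply/negP => vL.
have [uv|uv] := eqVneq v u.
  by have := cV (vin u); rewrite uR -uv vL /= andbF.
by have := cLR _ _ vL uR; rewrite /= split_edge_in.
Qed.

(** This is the test made by [pull_back]. For a vertex cut it amounts to the left side lying in
    V_out and the right side in V_in. *)
Definition oriented c : bool := [exists v, vout v \in left_side c].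

Lemma oriented_right c u :
  vertex_cut c -> oriented c -> vout u \notin right_side c.
Proof. by move=> cc /existsP[v]; apply: cut_out_notin_right. Qed.

Lemma oriented_left c u :
  vertex_cut c -> oriented c -> vin u \notin left_side c.
Proof.
move=> cc oc; have [_ _ /set0Pn[[v|v] vR] _] := cc.
  by have := oriented_right v cc oc; rewrite vR.
exact: cut_in_notin_left vR.
Qed.

(** The clique on V_in keeps every in-copy out of the left side, which is nonempty and so contains
    an out-copy. *)
Lemma oriented_sink c u : vertex_cut c -> vin u \in right_side c -> oriented c.
Proof.
move=> cc uR; have [_ /set0Pn[[v|v] vL] _ _] := cc.
  by apply/existsP; exists v.
by have := cut_in_notin_left v cc uR; rewrite vL.
Qed.

Lemma oriented_flip c : vertex_cut c -> ~~ oriented c -> oriented (flip c).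
Proof.
move=> cc oc; have [_ /set0Pn[[v|v] vL] _ _] := cc.
  by case/existsP: oc; exists v.
exact: (@oriented_sink _ v (vertex_cut_flip cc)).
Qed.

(** This allows later proofs to assume the cut oriented without loss of generality. *)
Lemma pull_back_flip c :
  vertex_cut c -> ~~ oriented c -> pull_back c = pull_back (flip c).
Proof.
move=> cc oc; have := oriented_flip cc oc.
by rewrite /pull_back -!/(oriented _) (negPf oc) => ->.
Qed.

Lemma pull_back_oriented c : oriented c ->
  pull_back c = Triple [set v | vout v \in left_side c]
    [set v | (vout v \in separator c) && (vin v \in separator c)]
    [set v | vin v \in right_side c].
Proof. by rewrite /pull_back -/(oriented _) => ->. Qed.

(** The three cases are membership of [v] in L, S and R of the pulled-back cut. Orientation leaves
    each copy two places; the fourth combination, [vout v] on the left and [vin v] on the right, is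
    excluded by the matching edge. *)
Lemma oriented_vertex c v : vertex_cut c -> oriented c ->
  [|| [&& vout v \in left_side c, vout v \notin separator c,
          vin v \in separator c & vin v \notin right_side c],
      [&& vout v \notin left_side c, vout v \in separator c,
          vin v \in separator c & vin v \notin right_side c]
    | [&& vout v \notin left_side c, vout v \in separator c,
          vin v \notin separator c & vin v \in right_side c]].
Proof.
move=> cc oc; have [/tripartitionP cV _ _ cLR] := cc.
have := cLR (vout v) (vin v); have := cV (vout v); have := cV (vin v).
rewrite /= split_edge_outin eqxx (negPf (oriented_left _ cc oc)).
rewrite (negPf (oriented_right _ cc oc)) /=.
by do 4!case: (_ \in _) => //=; move=> _ _ /(_ isT isT).
Qed.

(** * From vertex cuts of G' to vertex cuts of G *)

Lemma vertex_cut_pull_back c :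
  vertex_cut c -> vertex_cut (pull_back c : triple (directed G)).
Proof.
wlog oc : c / oriented c => [IH cc|cc].
  have [oc|oc] := boolP (oriented c); first exact: IH.
  rewrite pull_back_flip //.
  by apply: IH (vertex_cut_flip cc); apply: oriented_flip.
have [_ L0 /set0Pn[[v|v] vR] cLR] := cc.
  by have := oriented_right v cc oc; rewrite vR.
rewrite pull_back_oriented //; split=> /=.
- apply/tripartitionP => u /=; rewrite !inE; have := oriented_vertex u cc oc.
  by do 4!case: (_ \in _).
- by case/existsP: oc => u uL; apply/set0Pn; exists u; rewrite inE.
- by apply/set0Pn; exists v; rewrite inE.
- move=> u w; rewrite !inE => uL wR; have := cLR _ _ uL wR.
  by rewrite /= split_edge_outin negb_or => /andP[].
Qed.

Lemma cut_weight_split c : cut_weight c =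
  \sum_(v : G) ((vout v \in separator c) + (vin v \in separator c)) * dweight v.
Proof.
rewrite /cut_weight big_mkcond big_sumType /= -big_split /=.
by apply: eq_bigr => v _; rewrite mulnDl; do 2!case: (_ \in _); rewrite ?mul1n.
Qed.

Lemma cut_weight_pull_back c : vertex_cut c ->
  cut_weight c =
  \sum_(v : G) dweight v + cut_weight (pull_back c : triple (directed G)).
Proof.
wlog oc : c / oriented c => [IH cc|cc].
  have [/IH->//|oc] := boolP (oriented c).
  rewrite pull_back_flip // -IH //; last exact: vertex_cut_flip.
  exact: oriented_flip.
rewrite cut_weight_split pull_back_oriented // /cut_weight.
rewrite [X in _ + X]big_mkcond /=.
rewrite -big_split /=; apply: eq_bigr => v _; rewrite inE.
have := oriented_vertex v cc oc.
(* Every vertex has at least one copy in the separator, which accounts for the constant term; a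
   second copy is there exactly when the vertex lies in S. *)
by do 4!case: (_ \in _) => //=; rewrite ?mul1n ?mul2n ?addnn ?addn0.
Qed.

(** * From vertex cuts of G to vertex cuts of G' *)

Definition push_forward d : triple (undirected (split_graph G)) :=
  Triple
    [set x : split_vertex G | if x is inl v then v \in left_side d else false]
    [set x : split_vertex G | match x with
                              | inl v => v \notin left_side d
                              | inr v => v \notin right_side d
                              end]
    [set x : split_vertex G | if x is inr v then v \in right_side d else false].

Lemma vertex_cut_push_forward d : vertex_cut d -> vertex_cut (push_forward d).
Proof.
case=> /tripartitionP dV /set0Pn[u uL] /set0Pn[v vR] dLR; split.
- by apply/tripartitionP => -[w|w]; rewrite !inE; case: (_ \in _).
- by apply/set0Pn; exists (vout u); rewrite inE.
- by apply/set0Pn; exists (vin v); rewrite inE.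
case=> x [] y; rewrite !inE // => xL yR.
rewrite /= split_edge_outin negb_or (dLR _ _ xL yR) andbT.
(* A matching edge cannot cross, since the two sides of [d] are disjoint. *)
by apply/eqP => xy; have := dV x; rewrite xL xy yR /= andbF.
Qed.

(** The inverse is one-sided: [pull_back] sends a vertex cut of G' and its flip to the same cut. *)
Lemma push_forwardK d : vertex_cut d -> pull_back (push_forward d) = d.
Proof.
case=> /tripartitionP dV /set0Pn[u uL] _ _.
rewrite pull_back_oriented; last by apply/existsP; exists u; rewrite inE.
case: d dV {uL} => L S R dV; congr Triple; apply/setP => v; rewrite !inE //=.
by have := dV v; rewrite /=; do 3!case: (_ \in _).
Qed.

(** * Transfer of minimizers under side conditions *)

Variables (P : triple (undirected (split_graph G)) -> Prop).
Variables (Q : triple (directed G) -> Prop).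
Hypothesis P_pull : forall c, vertex_cut c -> P c -> Q (pull_back c).
Hypothesis Q_push : forall d, vertex_cut d -> Q d -> P (push_forward d).

(** Any competitor [d] in G is pushed forward to a competitor of [c] in G'. Both weights exceed
    those of the cuts of G by the same w(V), which cancels. *)
Lemma min_cut_pull_back c : min_cut P c -> min_cut Q (pull_back c).
Proof.
case=> cc Pc c_min; split; first exact: vertex_cut_pull_back.
  exact: P_pull.
move=> d dd Qd; have dd' := vertex_cut_push_forward dd.
have := c_min _ dd' (Q_push dd Qd).
by rewrite !cut_weight_pull_back // push_forwardK // leq_add2l.
Qed.

Lemma min_cut_or_none_pull_back o :
  min_cut_or_none P o -> min_cut_or_none Q (omap (@pull_back G) o).
Proof.
case: o => [c|] /=; first exact: min_cut_pull_back.
move=> noP d dd Qd.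
exact: noP (vertex_cut_push_forward dd) (Q_push dd Qd).
Qed.

End Split.

(** * Terminal sets and the side conditions of the five problems *)

Lemma card_split_terminals (G : wdigraph) (T : {set G}) :
  #|split_terminals T| = 2 * #|T|.
Proof.
rewrite cardsU !card_imset; [|exact: inr_inj|exact: inl_inj].
rewrite (_ : _ :&: _ = set0) ?cards0 ?subn0 ?mul2n ?addnn //.
apply/setP => x; rewrite !inE; apply/negP => /andP[].
by case/imsetP=> u _ -> /imsetP[].
Qed.

Lemma vout_split_terminals (G : wdigraph) (T : {set G}) v :
  (vout v \in split_terminals T) = (v \in T).
Proof.
rewrite inE mem_imset; last exact: inl_inj.
by case: imsetP => [[]//|_]; rewrite orbF.
Qed.

Lemma vin_split_terminals (G : wdigraph) (T : {set G}) v :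
  (vin v \in split_terminals T) = (v \in T).
Proof.
rewrite inE orbC mem_imset; last exact: inr_inj.
by case: imsetP => [[]//|_]; rewrite orbF.
Qed.

Lemma splits_terminals_pull_back (G : wdigraph) (T : {set G})
    (c : triple (undirected (split_graph G))) :
  vertex_cut c ->
  @splits_terminals (undirected (split_graph G)) (split_terminals T) c ->
  @splits_terminals (directed G) T (pull_back c).
Proof.
wlog oc : c / oriented c => [IH cc [LT RT]|cc].
  have [oc|oc] := boolP (oriented c); first exact: IH.
  (* The Steiner condition is symmetric in the two sides, so it survives the flip. *)
  rewrite pull_back_flip //.
  by apply: IH (vertex_cut_flip cc) _; first exact: oriented_flip.
rewrite pull_back_oriented // => -[/set0Pn[x] + /set0Pn[y]]; rewrite !inE.
(* Orientation leaves only a left terminal in V_out and a right terminal in V_in. *)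
case: x y => u [] v /andP[uL uT] /andP[vR vT];
  try by [have := oriented_right v cc oc; rewrite vR
         |have := oriented_left u cc oc; rewrite uL].
move: uT vT; rewrite -[_ || _]in_setU vout_split_terminals => uT.
rewrite -[_ || _]in_setU vin_split_terminals => vT.
by split; apply/set0Pn; [exists u | exists v]; rewrite !inE ?uL ?vR.
Qed.

Lemma splits_terminals_push_forward (G : wdigraph) (T : {set G})
    (d : triple (directed G)) :
  @splits_terminals (directed G) T d ->
  @splits_terminals (undirected (split_graph G)) (split_terminals T)
    (push_forward d).
Proof.
case=> /set0Pn[u /setIP[uL uT]] /set0Pn[v /setIP[vR vT]].
split; apply/set0Pn; [exists (vout u) | exists (vin v)]; apply/setIP.
  by rewrite vout_split_terminals inE.
by rewrite vin_split_terminals inE.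
Qed.

(** The vertex [vout s] in the left side is itself a witness of orientation. *)
Lemma separates_pull_back (G : wdigraph) (s t : G)
    (c : triple (undirected (split_graph G))) :
  @separates (undirected (split_graph G)) (vout s) (vin t) c ->
  @separates (directed G) s t (pull_back c).
Proof.
case=> sL tR; rewrite pull_back_oriented; last by apply/existsP; exists s.
by split; rewrite inE.
Qed.

Lemma has_source_pull_back (G : wdigraph) (s : G)
    (c : triple (undirected (split_graph G))) :
  @has_source (undirected (split_graph G)) (vout s) c ->
  @has_source (directed G) s (pull_back c).
Proof.
move=> sL; rewrite pull_back_oriented; last by apply/existsP; exists s.
by rewrite /has_source inE.
Qed.

Lemma has_sink_pull_back (G : wdigraph) (t : G)
    (c : triple (undirected (split_graph G))) :
  vertex_cut c -> @has_sink (undirected (split_graph G)) (vin t) c ->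
  @has_sink (directed G) t (pull_back c).
Proof.
move=> cc tR; rewrite pull_back_oriented; last exact: oriented_sink tR.
by rewrite /has_sink inE.
Qed.

Theorem theorem3p1 :
  (exists C : nat,
     forall G : wdigraph, #|edges (split_graph G)| <= C * #|dvertex G| ^ 2) /\
  (forall G : wdigraph,
     #|uvertex (split_graph G)| = 2 * #|dvertex G| /\
     (forall A : algorithm (global_cut undirected),
        correct_on A (split_graph G) -> correct_on (global_via A) G) /\
     (forall A : algorithm (all_pairs_cut undirected),
        correct_on A (split_graph G) -> correct_on (all_pairs_via A) G) /\
     (forall (A : algorithm (single_source_cut undirected)) (s : G),
        correct_on A (existT _ (split_graph G) (vout s)) ->
        correct_on (single_source_via A) (existT _ G s)) /\
     (forall (A : algorithm (single_sink_cut undirected)) (t : G),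
        correct_on A (existT _ (split_graph G) (vin t)) ->
        correct_on (single_sink_via A) (existT _ G t)) /\
     (forall T : {set G},
        #|split_terminals T| = 2 * #|T| /\
        (forall A : algorithm (steiner_cut undirected),
           correct_on A (existT _ (split_graph G) (split_terminals T)) ->
           correct_on (steiner_via A) (existT _ G T)))).
Proof.
split.
  (* The constant is that of (2n)^2 = 4n^2, from the bound by ordered pairs of vertices of G'. *)
  exists 4 => G; apply: leq_trans (card_edges _) _.
  by rewrite /= card_sum addnn -mul2n expnMn.
move=> G; split; first by rewrite /= card_sum addnn mul2n.
split=> [A A_ok /noncomplete_split/A_ok|].
  exact: min_cut_pull_back.
split=> [A A_ok /noncomplete_split/A_ok A_min s t|].
  apply: min_cut_or_none_pull_back (A_min _ _) => [c _|d _ [sL tR]].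
    exact: separates_pull_back.
  by split; rewrite inE.
split=> [A s A_ok /noncomplete_split/A_ok|].
  apply: min_cut_or_none_pull_back => [c _|d _ sL].
    exact: has_source_pull_back.
  by rewrite /has_source inE.
split=> [A t A_ok /noncomplete_split/A_ok|T].
  apply: min_cut_or_none_pull_back => [c|d _ tR].
    exact: has_sink_pull_back.
  by rewrite /has_sink inE.
split=> [|A A_ok /noncomplete_split/A_ok]; first exact: card_split_terminals.
apply: min_cut_or_none_pull_back => [c|d _].
  exact: splits_terminals_pull_back.
exact: splits_terminals_push_forward.
Qed.
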